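(* Let $\Psi:\mathbb{R}^S\times\mathbb{R}_{++}\to\mathbb{R}$ be defined by $$\Psi(\boldsymbol{z},\sigma):=\max_{\boldsymbol{x}\in\mathcal{X},\ \boldsymbol{y}\in\mathbb{R}^S_+}\Bigl\{-f(\boldsymbol{x})-\sigma\sum_{s=1}^S y_sz_s:\ g_s(\boldsymbol{x})\le y_s,\ \forall s\in[S]\Bigr\}.$$ Under the two assumptions (A1) and (A2) stated in the context, the function $\Psi(\boldsymbol{z},\sigma)$ is convex in $\boldsymbol{z}$ for every fixed $\sigma>0$.
   Context: $[n]=\{1,\dots,n\}$; $S,I$ are positive integers; $\mathbb{R}^S_+$ is the nonnegative orthant and $\mathbb{R}_{++}$ the set of positive reals. $\Xi\subseteq\mathbb{R}^{d_\xi}$ is the support of a random vector, $\xi^1,\dots,\xi^S\in\Xi$ are given sample realizations, and $g_s(\boldsymbol{x})=g(\boldsymbol{x},\xi^s)$ for $s\in[S]$. (A1) $\mathcal{X}\subseteq\mathbb{R}^d$ is compact, convex, and has a nonempty relative interior. (A2) $\mathcal{U}\subseteq\mathbb{R}^d$ is an open set containing $\mathcal{X}$; $f:\mathcal{U}\to\mathbb{R}$ is continuously differentiable and convex; $g:\mathcal{U}\times\Xi\to\mathbb{R}$ has the form $g(\boldsymbol{x},\xi)=\max_{i\in[I]}h_i(\boldsymbol{x},\xi)$, where $h_i:\mathbb{R}^d\times\Xi\to\mathbb{R}$ is continuously differentiable and convex in $\boldsymbol{x}$ for every $\xi\in\Xi$ and $i\in[I]$.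
   Formalization: Ψ cannot be real-valued on all of R^S: it is +∞ when z has a negative component. Here Ψ is a supremum in the extended reals, convex in z on all of R^S in that sense, and it is shown to be a real, attained maximum for z ≥ 0. *)

(* Defs.v *)
From HB Require Import structures.
From mathcomp Require Import all_boot all_order all_algebra.
From mathcomp Require Import all_classical all_reals all_analysis.

Set Implicit Arguments.
Unset Strict Implicit.
Unset Printing Implicit Defensive.

Import Order.TTheory GRing.Theory Num.Theory.
Import numFieldNormedType.Exports.

Local Open Scope classical_set_scope.
Local Open Scope ring_scope.

Definition affine_hull (R : realType) (E : normedModType R) (A : set E)
  : set E :=
  [set x | exists n (w : 'I_n -> R) (a : 'I_n -> E),
     [/\ forall i, A (a i), \sum_(i < n) w i = 1
       & x = \sum_(i < n) w i *: a i]].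

(* Interior of A in the topology induced on its affine hull. *)
Definition relative_interior (R : realType) (E : normedModType R) (A : set E)
  : set E :=
  [set x | A x /\ \forall y \near x, affine_hull A y -> A y].

Definition gradient (R : realType) (d : nat) (f : 'rV[R]_d -> R)
  (x : 'rV[R]_d) : 'rV[R]_d :=
  \row_(i < d) 'D_(delta_mx 0 i) f x.

(* Meant for an open set D; the values of f outside D are then irrelevant. *)
Definition continuously_differentiable_on (R : realType) (d : nat)
  (D : set 'rV[R]_d) (f : 'rV[R]_d -> R) : Prop :=
  (forall x, D x -> differentiable f x) /\
  (forall x, D x -> {for x, continuous (gradient f)}).

(* D itself need not be convex, so convexity is required on the convex
   subsets of D, i.e., along the segments contained in D. For convex D this is
   [convex_function D f]. *)
Definition convex_function_on (R : realType) (d : nat)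
  (D : set 'rV[R]_d) (f : 'rV[R]_d -> R) : Prop :=
  forall C : set 'rV[R]_d, C `<=` D ->
    @convex_set R 'rV[R]_d C -> @convex_function R 'rV[R]_d C f.

Definition convex_ereal_function (R : realType) (E : lmodType R)
  (F : E -> \bar R) : Prop :=
  forall (u v : E) (t : R), 0 <= t <= 1 ->
    (F (t *: u + (1 - t) *: v)%R <= t%:E * F u + (1 - t)%R%:E * F v)%E.

Section value_function.
Context (R : realType) (d S : nat).
Variables (X : set 'rV[R]_d) (f : 'rV[R]_d -> R)
          (gs : 'I_S -> 'rV[R]_d -> R).

Definition Psi_feasible : set ('rV[R]_d * 'rV[R]_S) :=
  [set p : 'rV[R]_d * 'rV[R]_S | [/\ X p.1, forall s, 0 <= p.2 0 s
             & forall s, gs s p.1 <= p.2 0 s]].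

Definition Psi_objective (z : 'rV[R]_S) (sigma : R)
  (p : 'rV[R]_d * 'rV[R]_S) : R :=
  - f p.1 - sigma * \sum_(s < S) p.2 0 s * z 0 s.

(* The components of y are unbounded above, so the value is +oo as soon as z
   has a negative component: the maximum is taken in the extended reals. *)
Definition Psi (z : 'rV[R]_S) (sigma : R) : \bar R :=
  ereal_sup [set (Psi_objective z sigma p)%:E | p in Psi_feasible].

End value_function.

(* Main.v *)
Require Import Defs.
From HB Require Import structures.
From mathcomp Require Import all_boot all_order all_algebra.
From mathcomp Require Import all_classical all_reals all_analysis.
From mathcomp Require Import ring.

Set Implicit Arguments.
Unset Strict Implicit.
Unset Printing Implicit Defensive.

Import Order.TTheory GRing.Theory Num.Theory.
Import numFieldNormedType.Exports.

Local Open Scope classical_set_scope.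
Local Open Scope ring_scope.

(** Two independent facts are combined.

    Convexity: for each feasible pair (x, y) the objective is an affine function
    of z, and the feasible set is the same for all z; so z |-> Psi z sigma is a
    pointwise supremum of affine functions ([convex_Psi]). Where z has a
    negative component the supremum is +oo, and the convexity inequality is
    read in the extended reals.

    Attainment for z >= 0: the unboundedness of y is harmless, because the
    objective does not increase with y, so that for a given x the best choice is
    the smallest feasible one, y_s = max (0, g_s x). This leaves the
    maximization over the compact set X of the function
      x |-> - f x - sigma * \sum_s max (0, g_s x) * z_s,
    which is continuous on X, and the extreme value theorem applies
    ([Psi_attained]). Continuity of f comes from its differentiability, and that
    of g_s from the differentiability of the h_i, because finite maxima preserve
    continuity ([continuous_big]). *)

(** Iterated from the right starting with [idx], a finite big operator is a
    composite of copies of the binary operation. The default value may depend on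
    the point so that the lemma covers, besides sums, the maximum of a nonempty
    family of functions, whose default value is one of its members. *)
Lemma continuous_big (T U : topologicalType) (J : Type) (r : seq J)
  (op : U -> U -> U) (idx : T -> U) (F : J -> T -> U) :
  continuous (fun uv : U * U => op uv.1 uv.2) -> continuous idx ->
  (forall j, continuous (F j)) ->
  continuous (fun x => \big[op/idx x]_(j <- r) F j x).
Proof.
move=> op_cont idx_cont F_cont x; elim: r => [|j r IHr].
  under eq_fun do rewrite big_nil.
  exact: idx_cont.
under eq_fun do rewrite big_cons.
apply: (@continuous2_cvg _ _ _ _ _ _ (F j)
  (fun y => \big[op/idx y]_(i <- r) F i y) op).
- exact: (op_cont (_, _)).
- exact: F_cont.
- exact: IHr.
Qed.

Section value_function_properties.
Context (R : realType) (d S : nat).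
Variables (X : set 'rV[R]_d) (f : 'rV[R]_d -> R).
Variable gs : 'I_S -> 'rV[R]_d -> R.

Let feasible := Psi_feasible X gs.

Lemma Psi_ubound (z : 'rV[R]_S) (sigma : R) p : feasible p ->
  ((Psi_objective f z sigma p)%:E <= Psi X f gs z sigma)%E.
Proof. by move=> p_feas; apply: ereal_sup_ubound; exists p. Qed.

Lemma Psi_objective_affine (u v : 'rV[R]_S) (t sigma : R) p :
  Psi_objective f (t *: u + (1 - t) *: v) sigma p =
  t * Psi_objective f u sigma p + (1 - t) * Psi_objective f v sigma p.
Proof.
rewrite /Psi_objective.
have -> : \sum_(s < S) p.2 0 s * (t *: u + (1 - t) *: v) 0 s =
    t * (\sum_(s < S) p.2 0 s * u 0 s) +
    (1 - t) * (\sum_(s < S) p.2 0 s * v 0 s).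
  by rewrite !mulr_sumr -big_split; apply: eq_bigr => s _ /=; rewrite !mxE; ring.
ring.
Qed.

(** A supremum of affine functions is convex. The weights 0 and 1 need no
    separate treatment even where the value is infinite, since 0 * +oo = 0 in
    the extended reals. *)
Lemma convex_Psi (sigma : R) :
  convex_ereal_function (fun z : 'rV[R]_S => Psi X f gs z sigma).
Proof.
move=> u v t /andP[t_ge0 t_le1].
apply: ge_ereal_sup => _ [p p_feas <-].
rewrite Psi_objective_affine EFinD !EFinM.
by apply: leeD; apply: lee_wpmul2l; rewrite ?lee_fin ?subr_ge0 //;
  exact: Psi_ubound.
Qed.

(** The smallest feasible y for a given x. *)
Definition least_slack (x : 'rV[R]_d) : 'rV[R]_S :=
  \row_s Order.max 0 (gs s x).

Lemma least_slack_feasible x : X x -> feasible (x, least_slack x).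
Proof. by move=> Xx; split=> //= s; rewrite mxE le_max lexx ?orbT. Qed.

(** With sigma, z >= 0 the objective is nonincreasing in each component of y. *)
Lemma Psi_objective_le_least_slack (z : 'rV[R]_S) (sigma : R) p :
  0 <= sigma -> (forall s, 0 <= z 0 s) -> feasible p ->
  Psi_objective f z sigma p <=
  Psi_objective f z sigma (p.1, least_slack p.1).
Proof.
move=> sigma_ge0 z_ge0 [_ y_ge0 gs_le_y].
rewrite lerD2l lerN2 ler_wpM2l //; apply: ler_sum => s _ /=.
by rewrite ler_wpM2r // mxE ge_max y_ge0 gs_le_y.
Qed.

Lemma continuous_Psi_objective_least_slack (z : 'rV[R]_S) (sigma : R) :
  {within X, continuous f} -> (forall s, {within X, continuous (gs s)}) ->
  {within X, continuous
    (fun x => Psi_objective f z sigma (x, least_slack x))}.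
Proof.
move=> f_cont gs_cont.
have slack_cont : {within X, continuous
    (fun x => \sum_(s < S) least_slack x 0 s * z 0 s)}.
  apply: (@continuous_big (subspace X) R _ _ +%R (fun=> 0)
    (fun s x => least_slack x 0 s * z 0 s)).
  - exact: add_continuous.
  - by move=> x; exact: cvg_cst.
  - move=> s x; apply: cvgMl.
    rewrite /continuous_at /least_slack mxE; under eq_fun do rewrite mxE.
    apply: (@max_fun_continuous _ (subspace X) R (fun=> 0) (gs s)).
      by move=> y; exact: cvg_cst.
    exact: gs_cont.
move=> x; apply: cvgB; first by apply: cvgN; exact: f_cont.
by apply: cvgMr; exact: slack_cont.
Qed.

(** Fixing y at its best value for each x leaves a continuous function of x
    alone, so the noncompactness of the range of y does no harm. *)
Lemma Psi_attained (z : 'rV[R]_S) (sigma : R) :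
  X !=set0 -> compact X ->
  {within X, continuous f} -> (forall s, {within X, continuous (gs s)}) ->
  0 <= sigma -> (forall s, 0 <= z 0 s) ->
  exists2 p, feasible p & Psi X f gs z sigma = (Psi_objective f z sigma p)%:E.
Proof.
move=> X_neq0 X_compact f_cont gs_cont sigma_ge0 z_ge0.
have [x /set_mem Xx x_max] := compact_EVT_max X_neq0 X_compact
  (continuous_Psi_objective_least_slack (z := z) (sigma := sigma)
     f_cont gs_cont).
exists (x, least_slack x); first exact: least_slack_feasible.
apply/eqP; rewrite eq_le Psi_ubound ?andbT; last exact: least_slack_feasible.
apply: ge_ereal_sup => _ [p p_feas <-]; rewrite lee_fin.
apply: (le_trans (Psi_objective_le_least_slack sigma_ge0 z_ge0 p_feas)).
by apply: x_max; case: p_feas => Xp _ _; exact: mem_set.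
Qed.

End value_function_properties.

Theorem proposition2p5 (R : realType) (d dxi S I : nat)
  (S_gt0 : (0 < S)%N) (I_gt0 : (0 < I)%N)
  (Xi : set 'rV[R]_dxi) (xi : 'I_S -> 'rV[R]_dxi)
  (xi_Xi : forall s, Xi (xi s))
  (X : set 'rV[R]_d)
  (X_compact : compact X)
  (X_convex : @convex_set R 'rV[R]_d X)
  (X_relint : relative_interior X !=set0)
  (U : set 'rV[R]_d) (U_open : open U) (X_sub_U : X `<=` U)
  (f : 'rV[R]_d -> R)
  (f_C1 : continuously_differentiable_on U f)
  (f_convex : convex_function_on U f)
  (h : 'I_I -> 'rV[R]_d -> 'rV[R]_dxi -> R)
  (h_C1 : forall i w, Xi w ->
     continuously_differentiable_on setT (fun x => h i x w))
  (h_convex : forall i w, Xi w ->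
     @convex_function R 'rV[R]_d setT (fun x => h i x w))
  (g : 'rV[R]_d -> 'rV[R]_dxi -> R)
  (g_max : forall x w, U x -> Xi w ->
     g x w = \big[Order.max/h (Ordinal I_gt0) x w]_(i < I) h i x w) :
  let gs := fun (s : 'I_S) (x : 'rV[R]_d) => g x (xi s) in
  forall sigma : R, 0 < sigma ->
    (* Psi(z, sigma) is a genuine (real, attained) maximum for z >= 0 *)
    (forall z : 'rV[R]_S, (forall s, 0 <= z 0 s) ->
       exists2 p, Psi_feasible X gs p
                & Psi X f gs z sigma = (Psi_objective f z sigma p)%:E) /\
    convex_ereal_function (fun z : 'rV[R]_S => Psi X f gs z sigma).
Proof.
move=> gs sigma sigma_gt0; split=> [z z_ge0|]; last exact: convex_Psi.
apply: Psi_attained => //.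
- by case: X_relint => x [Xx _]; exists x.
- apply: continuous_in_subspaceT => x /set_mem Xx.
  by apply: differentiable_continuous; apply: f_C1.1; exact: X_sub_U.
- move=> s.
  have max_cont : continuous (fun x =>
      \big[Order.max/h (Ordinal I_gt0) x (xi s)]_(i < I) h i x (xi s)).
    have h_cont i : continuous (fun x => h i x (xi s)).
      move=> x; apply: differentiable_continuous.
      exact: (h_C1 i _ (xi_Xi s)).1.
    apply: (@continuous_big 'rV[R]_d R _ _ Order.max
      (fun x => h (Ordinal I_gt0) x (xi s)) (fun i x => h i x (xi s))) => //.
    exact: max_continuous.
  (* g is that maximum on U only, which suffices for continuity within X *)
  apply: (@subspace_eq_continuous _ X R (fun x =>
      \big[Order.max/h (Ordinal I_gt0) x (xi s)]_(i < I) h i x (xi s))).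
    by move=> x /set_mem Xx; rewrite -g_max //; exact: X_sub_U.
  exact: continuous_subspaceT.
- exact: ltW.
Qed.
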